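(* Let $\mathfrak C$ be a left cancellative small category. The following are equivalent: (i) $I_l\ltimes\partial\Omega$ is minimal. (ii) $I_l\,\bar\ltimes\,\partial\Omega$ is minimal. (iii) For all non-empty $e,f\in\mathcal J$ there exist $s_1,\dots,s_n\in I_l$ such that for all non-empty $e'\in\mathcal J$ with $e'\le e$ there exists $1\le i\le n$ with $e'(s_ifs_i^{-1})\ne\emptyset$.
   Context: $\mathfrak C$ denotes the set of morphisms, $\mathfrak C^0\subseteq\mathfrak C$ the identity morphisms, $\mathfrak d,\mathfrak t$ domain and target; $cd$ is defined iff $\mathfrak d(c)=\mathfrak t(d)$; left cancellative means $cx=cy\Rightarrow x=y$. Each $c\in\mathfrak C$ gives the partial bijection $\mathfrak d(c)\mathfrak C\to c\mathfrak C$, $x\mapsto cx$; $I_l$ is the smallest semigroup of partial bijections of $\mathfrak C$ containing these and closed under inverses; $\mathcal J=\{\mathrm{dom}(s):s\in I_l\}$ is its semilattice of idempotents (product = intersection, $\le$ = inclusion; $sfs^{-1}$ corresponds to the set $s(f\cap\mathrm{dom}(s))$). $\bar{\mathcal J}$ is the set of subsets $\varepsilon=e\setminus\bigcup_{i=1}^nf_i$ with $e,f_i\in\mathcal J$, $f_i\subseteq e$. $\widehat{\mathcal J}$ is the space of non-zero multiplicative maps $\chi:\mathcal J\to\{0,1\}$ with $\chi(\emptyset)=0$ if $\emptyset\in\mathcal J$ (pointwise convergence). $\Omega\subseteq\widehat{\mathcal J}$ consists of those $\chi$ such that whenever $e=\bigcup_{i=1}^nf_i$ ($e,f_i\in\mathcal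 J$) and $\chi(e)=1$, then $\chi(f_i)=1$ for some $i$. For $\chi\in\Omega$, $\varepsilon=e\setminus\bigcup f_i$, put $\chi(\varepsilon)=1$ iff $\chi(e)=1$ and all $\chi(f_i)=0$, and $\chi(\varepsilon)=0$ otherwise. $\partial\Omega\subseteq\Omega$ is the closure of the set of $\chi\in\widehat{\mathcal J}$ with $\chi^{-1}(1)$ maximal. $s\in I_l$ acts by $\chi\mapsto s.\chi=\chi(s^{-1}\cdot s)$ from $\{\chi\in\partial\Omega:\chi(s^{-1}s)=1\}$ onto $\{\chi\in\partial\Omega:\chi(ss^{-1})=1\}$. $I_l\ltimes\partial\Omega$ (resp. $I_l\,\bar\ltimes\,\partial\Omega$) is the étale groupoid of classes of pairs $(s,\chi)$ with $\chi\in\partial\Omega$, $\chi(s^{-1}s)=1$, where $(s,\chi)$ and $(t,\psi)$ are identified iff $\chi=\psi$ and the restrictions satisfy $se=te$ for some $e\in\mathcal J$ with $\chi(e)=1$ (resp. $s\varepsilon=t\varepsilon$ for some $\varepsilon\in\bar{\mathcal J}$ with $\chi(\varepsilon)=1$); source $\chi$, range $s.\chi$; unit space $\partial\Omega$. A groupoid is minimal if its unit space has no closed invariant subsets other than $\emptyset$ and the whole unit space. *)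

(* Defs.v *)
From HB Require Import structures.
From mathcomp Require Import all_boot.
From mathcomp Require Import generic_quotient.
From mathcomp Require Import all_classical.
From mathcomp Require Import topology.

Set Implicit Arguments.
Unset Strict Implicit.
Unset Printing Implicit Defensive.

Local Open Scope classical_set_scope.
Local Open Scope quotient_scope.

(* Topological groupoids whose source map is a local homeomorphism. The unit
   space is [gob], embedded in [garr] by [gunit]. The product [gmul g h] is
   meaningful only when [gsrc g = grng h]. *)
Record etaleGroupoid := EtaleGroupoid {
  gob : topologicalType;
  garr : topologicalType;
  gsrc : garr -> gob;
  grng : garr -> gob;
  gunit : gob -> garr;
  ginv : garr -> garr;
  gmul : garr -> garr -> garr;
  gsrc_unit : forall x, gsrc (gunit x) = x;
  grng_unit : forall x, grng (gunit x) = x;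
  gsrc_mul : forall g h, gsrc g = grng h -> gsrc (gmul g h) = gsrc h;
  grng_mul : forall g h, gsrc g = grng h -> grng (gmul g h) = grng g;
  gmul_assoc : forall g h k, gsrc g = grng h -> gsrc h = grng k ->
    gmul g (gmul h k) = gmul (gmul g h) k;
  gmul_unit : forall g, gmul g (gunit (gsrc g)) = g;
  gunit_mul : forall g, gmul (gunit (grng g)) g = g;
  gsrc_inv : forall g, gsrc (ginv g) = grng g;
  grng_inv : forall g, grng (ginv g) = gsrc g;
  ginv_mul : forall g, gmul (ginv g) g = gunit (gsrc g);
  gmul_inv : forall g, gmul g (ginv g) = gunit (grng g);
  gsrc_continuous : continuous gsrc;
  grng_continuous : continuous grng;
  gunit_continuous : continuous gunit;
  ginv_continuous : continuous ginv;
  gmul_continuous :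
    {within [set gh | gsrc gh.1 = grng gh.2],
      continuous (fun gh => gmul gh.1 gh.2)};
  gsrc_etale : forall g, exists U : set garr,
    [/\ open U, U g, {in U &, injective gsrc} &
        forall V, open V -> V `<=` U -> open (gsrc @` V)]
}.

Definition invariant (G : etaleGroupoid) (A : set (gob G)) :=
  forall g : garr G, A (gsrc g) -> A (grng g).

Definition minimal (G : etaleGroupoid) :=
  forall A : set (gob G), closed A -> invariant A -> A = set0 \/ A = setT.

(* A small category is its set of morphisms. Objects are identified with their
   identity morphisms, so [dom] and [tgt] take values in the identities, which
   are the [c] with [dom c = c]. The product [c * d], written [comp c d], is
   meaningful only when [dom c = tgt d]; its other values are irrelevant. *)
Record smallCategory := SmallCategory {
  mor :> Type;
  dom : mor -> mor;
  tgt : mor -> mor;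
  comp : mor -> mor -> mor;
  dom_dom : forall c, dom (dom c) = dom c;
  tgt_dom : forall c, tgt (dom c) = dom c;
  dom_tgt : forall c, dom (tgt c) = tgt c;
  tgt_tgt : forall c, tgt (tgt c) = tgt c;
  dom_comp : forall c d, dom c = tgt d -> dom (comp c d) = dom d;
  tgt_comp : forall c d, dom c = tgt d -> tgt (comp c d) = tgt c;
  comp_assoc : forall b c d, dom b = tgt c -> dom c = tgt d ->
    comp b (comp c d) = comp (comp b c) d;
  comp_dom : forall c, comp c (dom c) = c;
  comp_tgt : forall c, comp (tgt c) c = c
}.

Definition left_cancellative (C : smallCategory) :=
  forall c x y : C, dom c = tgt x -> dom c = tgt y ->
    comp c x = comp c y -> x = y.

(* Partial bijections of [T], as graphs: [s x y] means that [s] is defined at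
   [x] with value [y]. *)
Record pbij (T : Type) := Pbij {
  graph :> T -> T -> Prop;
  pbij_fun : forall x y y', graph x y -> graph x y' -> y = y';
  pbij_inj : forall x x' y, graph x y -> graph x' y -> x = x'
}.

Section PartialBijections.
Variable T : Type.
Implicit Types (s t : pbij T) (A : set T).

Definition pdom s : set T := [set x | exists y, s x y].

Definition pimage s A : set T := [set y | exists2 x, A x & s x y].

Definition pinv s : pbij T :=
  @Pbij T (fun x y => s y x) (fun x y y' => @pbij_inj T s y y' x)
    (fun x x' y => @pbij_fun T s y x x').

Lemma pmul_fun s t x z z' : (exists2 y, t x y & s y z) ->
  (exists2 y, t x y & s y z') -> z = z'.
Proof.
move=> [y txy syz] [y' /(pbij_fun txy) <-]; exact: pbij_fun syz.
Qed.

Lemma pmul_inj s t x x' z : (exists2 y, t x y & s y z) ->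
  (exists2 y, t x' y & s y z) -> x = x'.
Proof.
move=> [y txy syz] [y' t' s']; rewrite (pbij_inj s' syz) in t'.
exact: pbij_inj txy t'.
Qed.

(* The product [s t], which applies [t] first. *)
Definition pmul s t : pbij T :=
  @Pbij T (fun x z => exists2 y, t x y & s y z) (@pmul_fun s t) (@pmul_inj s t).

Lemma pid_fun A x y y' : A x /\ x = y -> A x /\ x = y' -> y = y'.
Proof. by move=> [_ <-] [_ <-]. Qed.

Lemma pid_inj A x x' y : A x /\ x = y -> A x' /\ x' = y -> x = x'.
Proof. by move=> [_ ->] [_ ->]. Qed.

(* The identity of [A]; this is how a set is regarded as an idempotent. *)
Definition pid A : pbij T :=
  @Pbij T (fun x y => A x /\ x = y) (@pid_fun A) (@pid_inj A).

(* The restriction [s A]. *)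
Definition prestr s A := pmul s (pid A).

(* The set corresponding to the idempotent [s A s^-1]. *)
Definition pconj s A : set T := pimage s (A `&` pdom s).

Lemma pbijP s t : (forall x y, s x y <-> t x y) -> s = t.
Proof.
case: s t => [g f i] [g' f' i'] /= h.
have e : g = g' by apply/funext => x; apply/funext => y; exact/propext.
by subst g'; rewrite (Prop_irrelevance f f') (Prop_irrelevance i i').
Qed.

Lemma prestrE s t A : prestr s A = prestr t A ->
  forall x y, A x -> s x y <-> t x y.
Proof.
move=> e x y Ax; split=> h.
  have : prestr s A x y by exists x.
  by rewrite e => -[_ [_ <-]].
have : prestr t A x y by exists x.
by rewrite -e => -[_ [_ <-]].
Qed.

Lemma prestrP s t A : (forall x y, A x -> s x y <-> t x y) ->
  prestr s A = prestr t A.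
Proof.
move=> h; apply: pbijP => x y /=; split=> -[z [Ax <-]] /h h'; exists x => //;
  exact: h'.
Qed.

End PartialBijections.

Section LeftCancellative.
Variables (C : smallCategory) (hC : left_cancellative C).

Lemma lmul_fun (c x y y' : C) : dom c = tgt x /\ y = comp c x ->
  dom c = tgt x /\ y' = comp c x -> y = y'.
Proof. by move=> [_ ->] [_ ->]. Qed.

Lemma lmul_inj (c x x' y : C) : dom c = tgt x /\ y = comp c x ->
  dom c = tgt x' /\ y = comp c x' -> x = x'.
Proof. by move=> [dx ->] [dx']; apply: hC. Qed.

(* The bijection [x |-> c x] from [dom c C] onto [c C]. *)
Definition lmul (c : C) : pbij C :=
  @Pbij C (fun x y => dom c = tgt x /\ y = comp c x) (@lmul_fun c) (@lmul_inj c).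

(* The left inverse hull. *)
Inductive Il : set (pbij C) :=
| Il_lmul c : Il (lmul c)
| Il_mul s t : Il s -> Il t -> Il (pmul s t)
| Il_inv s : Il s -> Il (pinv s).

Definition calJ : set (set C) := [set pdom s | s in Il].

Lemma calJ_setI e f : calJ e -> calJ f -> calJ (e `&` f).
Proof.
move=> [s hs <-] [t ht <-].
exists (pmul (pmul (pinv s) s) (pmul (pinv t) t)).
  by do !constructor.
rewrite eqEsubset; split=> x /=.
  move=> [y [z [u tu tz] [v sv sy]]].
  have eq_zx := @pbij_inj _ t _ _ _ tz tu; subst z.
  by split; [exists v | exists u].
move=> [[v sv] [u tu]].
by exists x; exists x; [exists u|exists v].
Qed.

Lemma calJ_preim s e : Il s -> calJ e -> calJ (pimage (pinv s) e).
Proof.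
move=> hs [t ht <-]; exists (pmul t s); first by constructor.
rewrite eqEsubset; split=> x /=.
  by move=> [z [y sy tz]]; exists y => //; exists z.
by move=> [y [z tz] sy]; exists z; exists y.
Qed.

Lemma Il_pid e : calJ e -> Il (pid e).
Proof.
move=> [s hs <-].
suff -> : pid (pdom s) = pmul (pinv s) s by do !constructor.
apply: pbijP => x y /=; split.
  by move=> [[z sz] <-]; exists z.
by move=> [z sz sy]; rewrite (@pbij_inj _ s _ _ _ sz sy); split=> //; exists z.
Qed.

Local Notation J := (set_type calJ).
Local Notation I := (set_type Il).
Implicit Types (chi psi : {ptws J -> bool}) (s t : I).

Definition Jcap (e f : J) : J :=
  exist _ (val e `&` val f)
    (mem_set (calJ_setI (set_mem (valP e)) (set_mem (valP f)))).

(* The domain of [s], corresponding to [s^-1 s]. *)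
Definition Jdom (s : I) : J :=
  exist _ (pdom (val s)) (mem_set (ex_intro2 _ _ _ (set_mem (valP s)) erefl)).

(* The preimage of [e] under [s], corresponding to [s^-1 e s]. *)
Definition Jpre (s : I) (e : J) : J :=
  exist _ (pimage (pinv (val s)) (val e))
    (mem_set (calJ_preim (set_mem (valP s)) (set_mem (valP e)))).

Definition Imul (s t : I) : I :=
  exist _ (pmul (val s) (val t))
    (mem_set (Il_mul (set_mem (valP s)) (set_mem (valP t)))).

Definition Iinv (s : I) : I :=
  exist _ (pinv (val s)) (mem_set (Il_inv (set_mem (valP s)))).

Definition Iid (e : J) : I :=
  exist _ (pid (val e)) (mem_set (Il_pid (set_mem (valP e)))).

Definition Jhat : set {ptws J -> bool} :=
  [set chi : {ptws J -> bool} | [/\ exists e, chi e,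
                forall e f, chi (Jcap e f) = chi e && chi f &
                forall e, val e = set0 -> chi e = false]].

Definition Jhat_max : set {ptws J -> bool} :=
  [set chi : {ptws J -> bool} | Jhat chi /\
    forall psi : {ptws J -> bool}, Jhat psi ->
      [set e | chi e] `<=` [set e | psi e] ->
      [set e | chi e] = [set e | psi e]].

Definition Omega : set {ptws J -> bool} :=
  [set chi : {ptws J -> bool} | Jhat chi /\
    forall (e : J) n (f : 'I_n -> J),
      val e = \bigcup_i val (f i) -> chi e -> exists i, chi (f i)].

(* The closure is taken in the subspace [Omega]. *)
Definition bdOmega : set {ptws J -> bool} := closure Jhat_max `&` Omega.

Local Notation X := (set_type bdOmega).

(* The action [s . chi = chi (s^-1 _ s)]. *)
Definition act (s : I) (chi : {ptws J -> bool}) : {ptws J -> bool} :=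
  fun e => chi (Jpre s e).

(* [chi A = 1] for [A] in [calJ]. *)
Definition in_char (chi : {ptws J -> bool}) : set (set C) :=
  [set A | exists2 e : J, val e = A & chi e].

(* [chi A = 1] for [A = e \ (f_1 U ... U f_n)] with [e], [f_i] in [calJ] and
   [f_i] contained in [e]; for [chi] in [Omega] this does not depend on the way
   in which [A] is written. The number [n] may be zero. *)
Definition in_charbar (chi : {ptws J -> bool}) : set (set C) :=
  [set A | exists e n (f : 'I_n -> J),
    [/\ forall i, val (f i) `<=` val e, A = val e `\` \bigcup_i val (f i),
        chi e & forall i, chi (f i) = false]].


Lemma in_charP chi (e : J) : in_char chi (val e) <-> chi e.
Proof. by split=> [[f /val_inj ->]|h] //; exists e. Qed.

Lemma in_char_charbar chi A : in_char chi A -> in_charbar chi A.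
Proof.
move=> [e <- he]; exists e, 0, (fun=> e); split=> //; try by case.
rewrite (_ : \bigcup_i _ = set0) ?setD0// -subset0 => x [] [].
by case.
Qed.

Lemma Jhat_le chi (e f : J) : Jhat chi -> val e `<=` val f -> chi e -> chi f.
Proof.
move=> [_ chiM _] ef he; have := chiM e f.
rewrite (_ : Jcap e f = e) ?he; last exact/val_inj/setIidl.
by move=> /esym.
Qed.

Lemma JpreI s e f : Jpre s (Jcap e f) = Jcap (Jpre s e) (Jpre s f).
Proof.
apply: val_inj; rewrite /= eqEsubset; split=> x /=.
  by move=> [y [ey fy] sy]; split; exists y.
move=> [[y ey sy] [y' fy sy']]; exists y => //; split=> //.
by rewrite (@pbij_fun _ (val s) _ _ _ sy sy').
Qed.

Lemma Jpre_Jdom s t : Jpre t (Jdom s) = Jdom (Imul s t).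
Proof.
apply: val_inj; rewrite /= eqEsubset; split=> x /=.
  by move=> [y [z sz] ty]; exists z; exists y.
by move=> [z [y ty sz]]; exists y => //; exists z.
Qed.

Lemma Jdom_mulVl s : Jdom (Imul (Iinv s) s) = Jdom s.
Proof.
apply: val_inj; rewrite /= eqEsubset; split=> x /=.
  by move=> [z [y sy _]]; exists y.
by move=> [y sy]; exists x; exists y.
Qed.

Lemma act_mul s t chi : act (Imul s t) chi = act s (act t chi).
Proof.
apply/funext => e; rewrite /act; congr (chi _); apply: val_inj.
rewrite /= eqEsubset; split=> x /=.
  by move=> [z ez [y ty sz]]; exists y => //; exists z.
by move=> [y [z ez sz] ty]; exists z => //; exists y.
Qed.

Lemma act_dom_inv s chi : act s chi (Jdom (Iinv s)) = chi (Jdom s).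
Proof. by rewrite /act Jpre_Jdom Jdom_mulVl. Qed.

Lemma actK s chi : Jhat chi -> chi (Jdom s) -> act (Iinv s) (act s chi) = chi.
Proof.
move=> [_ chiM _] hs; apply/funext => e; rewrite /act.
have -> : Jpre s (Jpre (Iinv s) e) = Jcap e (Jdom s).
  apply: val_inj; rewrite /= eqEsubset; split=> x /=.
    move=> [y [z ez sz] sy].
    by have <- := @pbij_inj _ (val s) _ _ _ sz sy; split=> //; exists y.
  by move=> [ex [y sy]]; exists y => //; exists x.
by rewrite chiM hs andbT.
Qed.

Lemma IinvK s : Iinv (Iinv s) = s.
Proof. by apply: val_inj; exact: pbijP. Qed.

Lemma actKV s chi :
  Jhat chi -> chi (Jdom (Iinv s)) -> act s (act (Iinv s) chi) = chi.
Proof. by move=> hchi hs; rewrite -[X in act X](IinvK s) actK. Qed.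

Lemma Jhat_act s chi : Jhat chi -> chi (Jdom s) -> Jhat (act s chi).
Proof.
move=> [_ chiM chi0] hs; split.
- by exists (Jdom (Iinv s)); rewrite act_dom_inv.
- by move=> e f; rewrite /act JpreI chiM.
- move=> e e0; apply: chi0; rewrite /= e0 -subset0 => x [y []].
Qed.

Lemma Jhat_max_act s chi :
  Jhat_max chi -> chi (Jdom s) -> Jhat_max (act s chi).
Proof.
move=> [hchi chimax] hs; split; first exact: Jhat_act.
move=> psi hpsi le.
have psiV : psi (Jdom (Iinv s)) by apply: le; rewrite /= act_dom_inv.
have sub : [set e | chi e] `<=` [set e | act (Iinv s) psi e].
  by move=> f /=; rewrite -{1}(actK hchi hs) => /le.
have eq_chi := chimax _ (Jhat_act hpsi psiV) sub.
suff -> : act s chi = psi by [].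
rewrite -(actKV hpsi psiV); congr act; apply/funext => e.
by apply/idP/idP => h; [have : [set e | chi e] e by [] |
  have : [set e | act (Iinv s) psi e] e by []]; rewrite ?eq_chi// -eq_chi.
Qed.

Lemma Omega_act s chi : Omega chi -> chi (Jdom s) -> Omega (act s chi).
Proof.
move=> [hchi chiU] hs; split; first exact: Jhat_act.
move=> e n f ef; apply: (chiU (Jpre s e)); rewrite /= ef eqEsubset; split=> x /=.
  by move=> [y [i _ fy] sy]; exists i => //; exists y.
by move=> [i _ [y fy sy]]; exists y => //; exists i.
Qed.

Lemma eval_continuous (e : J) : continuous (fun chi => chi e).
Proof. exact: (@proj_continuous J (fun=> bool) e). Qed.

Lemma act_continuous s : continuous (act s).
Proof.
move=> chi; apply/cvg_sup => e U [_ [[W oW <-] /= Wchi] sWU].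
have := @eval_continuous (Jpre s e) chi W (open_nbhs_nbhs (conj oW Wchi)).
apply: (@filterS _ (nbhs chi) _ [set psi | W (psi (Jpre s e))]
  [set psi | U (act s psi)]) => psi; exact: sWU.
Qed.

Lemma near_char_eq chi (e : J) : \forall psi \near chi, psi e = chi e.
Proof. exact: (@eval_continuous e chi [set chi e] (discrete_set1 _)). Qed.

Lemma near_char chi (e : J) : chi e -> nbhs chi [set psi : {ptws J -> bool} | psi e].
Proof.
by move=> he; have := near_char_eq chi e; apply: filterS => psi /= ->.
Qed.

Lemma bdOmega_act s chi : bdOmega chi -> chi (Jdom s) -> bdOmega (act s chi).
Proof.
move=> [clchi omchi] hs; split; last exact: Omega_act.
move=> U /act_continuous nU0; have nU : nbhs chi (act s @^-1` U) by exact: nU0.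
have [psi [mpsi [Upsi psis]]] := clchi _ (filterI nU (near_char hs)).
by exists (act s psi); split=> //; exact: Jhat_max_act.
Qed.

Lemma Jhat_max_extend chi (f : J) : Jhat_max chi ->
  (forall g, chi g -> val g `&` val f !=set0) -> chi f.
Proof.
move=> [hchi chimax] meets; have [[e he] chiM chi0] := hchi.
pose psi : {ptws J -> bool} :=
  fun h => `[< exists2 g : J, chi g & val g `&` val f `<=` val h >].
have hpsi : Jhat psi; first split.
- by exists e; apply/asboolP; exists e.
- move=> h k; apply/asboolP/andP => [[g hg sub]|[]].
    by split; apply/asboolP; exists g => // x /sub [].
  move=> /asboolP[g hg sub] /asboolP[g' hg' sub'].
  exists (Jcap g g'); first by rewrite chiM hg hg'.
  by move=> x /= [[gx gx'] fx]; split; [exact: sub | exact: sub'].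
- move=> h h0; apply/asboolP => -[g /meets[x gfx] sub].
  by have := sub x gfx; rewrite h0.
have sub : [set e | chi e] `<=` [set e | psi e].
  by move=> g hg; apply/asboolP; exists g => // x [].
have : [set e | psi e] f by apply/asboolP; exists e => // x [].
by rewrite -(chimax psi hpsi sub).
Qed.

Lemma Jhat_max_Omega : Jhat_max `<=` Omega.
Proof.
move=> chi mchi; have [hchi _] := mchi; have [_ chiM chi0] := hchi.
split=> // e n f ef he; apply: contrapT => nf.
have dis i : exists2 g : J, chi g & val g `&` val (f i) = set0.
  apply: contrapT => h; apply: nf; exists i; apply: Jhat_max_extend => // g hg.
  by apply/set0P/eqP => gf0; apply: h; exists g.
have [a [ha ae adis]] : exists a : J, [/\ chi a, val a `<=` val e &
    forall i, i \in enum 'I_n -> val a `&` val (f i) = set0].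
  elim: (enum 'I_n) => [|i s [a [ha ae adis]]]; first by exists e; split.
  have [g hg g0] := dis i; exists (Jcap a g); split.
  - by rewrite chiM ha hg.
  - by move=> x [/ae].
  - move=> j; rewrite inE => /predU1P[->|/adis aj].
      by rewrite /= -setIA g0 setI0.
    by rewrite /= -setIA [X in _ `&` X]setIC setIA aj set0I.
suff a0 : val a = set0 by rewrite (chi0 a a0) in ha.
rewrite -subset0 => x ax; have := ae x ax; rewrite ef => -[i _ fx].
by rewrite -(adis i _) ?mem_enum.
Qed.

Definition bdact s (chi : X) (h : val chi (Jdom s)) : X :=
  exist _ (act s (val chi)) (mem_set (bdOmega_act (set_mem (valP chi)) h)).

Lemma valX (chi : X) : bdOmega (val chi).
Proof. exact: set_mem (valP chi). Qed.

Lemma JhatX (chi : X) : Jhat (val chi).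
Proof. by case: (valX chi) => _ []. Qed.

Lemma near_valX (chi : X) (U : set {ptws J -> bool}) :
  nbhs (val chi) U -> nbhs chi [set psi : X | U (val psi)].
Proof. exact: (@initial_continuous X _ set_val chi). Qed.

Lemma near_bdact s (chi : X) (h : val chi (Jdom s)) (U : set X) :
  nbhs (bdact h) U ->
  nbhs chi [set psi : X | forall h' : val psi (Jdom s), U (bdact h')].
Proof.
move=> [_ [[W oW <-] /= Wchi] sWU].
have nW : nbhs (val chi) (act s @^-1` W).
  exact: (@act_continuous s (val chi) W (open_nbhs_nbhs (conj oW Wchi))).
by apply: filterS (near_valX nW) => psi /= Wpsi h'; exact: sWU.
Qed.

(* What is needed of the sets on which germs are compared in order that the
   germs form an etale groupoid. *)
Record germFamily := GermFamily {
  gfam :> X -> set (set C);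
  gfam_near : forall (chi : X) A, gfam chi A -> nbhs chi [set psi : X | gfam psi A];
  gfam_val : forall (chi : X) (e : J), val chi e -> gfam chi (val e);
  gfam_setI : forall (chi : X) A B, gfam chi A -> gfam chi B -> gfam chi (A `&` B);
  gfam_le : forall (chi : X) A (e f : J), gfam chi A ->
    val e `&` A `<=` val f -> val chi e -> val chi f;
  gfam_pre : forall s (chi : X) (h : val chi (Jdom s)) A,
    gfam (bdact h) A -> gfam chi (pimage (pinv (val s)) A)
}.

Definition char_family : germFamily.
Proof.
apply: (@GermFamily (fun chi : X => in_char (val chi))).
- move=> chi A [e <- he]; apply: filterS (near_valX (near_char he)) => psi /= h.
  by exists e.
- by move=> chi e he; exists e.
- move=> chi A B [e <- he] [f <- hf]; exists (Jcap e f) => //.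
  by case: (JhatX chi) => _ -> _; rewrite he hf.
- move=> chi A e f [g <- hg] sub he.
  have : val chi (Jcap e g) by case: (JhatX chi) => _ -> _; rewrite he.
  exact: Jhat_le (JhatX chi) _.
- by move=> s chi h A [e <- he]; exists (Jpre s e).
Defined.

Definition charbar_family : germFamily.
Proof.
apply: (@GermFamily (fun chi : X => in_charbar (val chi))).
- move=> chi A [e [n [f [fe -> he hf]]]].
  have nf : nbhs (val chi)
      [set psi : {ptws J -> bool} | forall i, psi (f i) = false].
    have near_f i : nbhs (val chi) [set psi : {ptws J -> bool} | psi (f i) = false].
      by have := near_char_eq (val chi) (f i); rewrite hf.
    exact: (@filter_forall {ptws J -> bool} 'I_n
      (fun i psi => psi (f i) = false) (nbhs (val chi)) _ near_f).
  apply: filterS (near_valX (filterI (near_char he) nf)) => psi /= [h h'].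
  by exists e, n, f.
- by move=> chi e he; apply: in_char_charbar; exists e.
- move=> chi A B [e [n [f [fe -> he hf]]]] [e' [n' [f' [fe' -> he' hf']]]].
  case: (JhatX chi) => _ chiM _.
  exists (Jcap e e'), (n + n'), (fun i => match fintype.split i with
    | inl j => Jcap (f j) e' | inr j => Jcap e (f' j) end); split.
  + move=> i x; case: fintype.splitP => j _ /= [h h']; split=> //; first exact: fe h.
    exact: fe' h'.
  + rewrite eqEsubset; split=> x /=.
      move=> [[ex nx] [ex' nx']]; split=> // -[i _]; case: fintype.splitP => j _ [h h'].
        by apply: nx; exists j.
      by apply: nx'; exists j.
    move=> [[ex ex'] nx]; split; split=> // -[j _ h]; apply: nx.
      exists (lshift n' j) => //; rewrite (unsplitK (inl j)); by split.
    exists (rshift n j) => //; rewrite (unsplitK (inr j)); by split.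
  + by rewrite chiM he he'.
  + by move=> i; case: fintype.splitP => j _; rewrite chiM ?hf ?hf' ?andbF.
- move=> chi A e f [g [n [k [kg -> hg hk]]]] sub he.
  case: (JhatX chi) => _ chiM _.
  pose k' (i : 'I_(n + 1)) : J := Jcap (Jcap e g)
    (match fintype.split i with inl j => k j | inr _ => f end).
  have [i] : exists i, val chi (k' i).
    case: (valX chi) => _ [_ chiU].
    apply: (@chiU (Jcap e g) (n + 1) k'); last by rewrite chiM he hg.
    rewrite eqEsubset; split=> x /=.
      move=> [ex gx]; have [[j _ kx]|nkx] := pselect ((\bigcup_i val (k i)) x).
        by exists (lshift 1 j) => //; rewrite /k' (unsplitK (inl j)).
      exists (rshift n ord0) => //; rewrite /k' (unsplitK (inr ord0)); split=> //.
      exact: sub.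
    by move=> [i _ []].
  by rewrite /k' chiM; case: fintype.splitP => j _; rewrite ?hk ?andbF // => /andP[].
- move=> s chi h A [e [n [f [fe -> he hf]]]].
  exists (Jpre s e), n, (fun i => Jpre s (f i)); split=> //.
    by move=> i x /= [y fy sy]; exists y => //; exact: fe fy.
  rewrite eqEsubset; split=> x /=.
    move=> [y [ey ny] sy]; split; first by exists y.
    move=> [i _ [z fz sz]]; apply: ny; exists i => //.
    by rewrite (@pbij_fun _ (val s) _ _ _ sy sz).
  move=> [[y ey sy] nx]; exists y => //; split=> // -[i _ fy]; apply: nx.
  by exists i => //; exists y.
Defined.

Section Germs.
Variable N : germFamily.

(* A pair [(s, chi)] with [chi (s^-1 s) = 1]. *)
Record gpair := GPair {
  gel : I;
  gpt : X;
  gdom : val gpt (Jdom gel)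
}.

HB.instance Definition _ := gen_eqMixin gpair.
HB.instance Definition _ := gen_choiceMixin gpair.

Definition germ_rel (p q : gpair) :=
  gpt p = gpt q /\
  exists2 A, gfam N (gpt p) A & prestr (val (gel p)) A = prestr (val (gel q)) A.

Lemma germ_relC p q : germ_rel p q -> germ_rel q p.
Proof. by move=> [e [A hA eA]]; split=> //; exists A => //; rewrite -e. Qed.

Lemma germ_rel_equiv : equiv_class_of (fun p q => `[< germ_rel p q >]).
Proof.
split=> [p|p q|q p r].
- apply/asboolP; split=> //; exists (val (Jdom (gel p))) => //.
  exact/gfam_val/gdom.
- by apply/asboolP/asboolP; exact: germ_relC.
- move=> /asboolP[epq [A hA eA]] /asboolP[eqr [B hB eB]]; apply/asboolP.
  split; first by rewrite epq.
  exists (A `&` B); first by apply: gfam_setI => //; rewrite epq.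
  apply: prestrP => x y [Ax Bx]; rewrite (prestrE eA _ Ax).
  exact: (prestrE eB _ Bx).
Qed.

Canonical germ_equiv := EquivRelPack germ_rel_equiv.

Definition germ := {eq_quot germ_equiv}.
HB.instance Definition _ := Choice.on germ.

Definition mkgerm (p : gpair) : germ := \pi_{eq_quot germ_equiv} p.

Definition germ_repr (g : germ) : gpair := repr (g : {eq_quot germ_equiv}).

Lemma germ_reprK g : mkgerm (germ_repr g) = g.
Proof. exact: reprK. Qed.

Lemma germP p q : mkgerm p = mkgerm q <-> germ_rel p q.
Proof.
split=> [/eqmodP/asboolP//|h].
by apply/eqmodP/asboolP.
Qed.

(* The topology with basis the sets [{[s, chi] : chi in U}], for [s] in [I] and
   [U] open. *)
Definition germ_open (O : set germ) :=
  forall p, O (mkgerm p) -> nbhs (gpt p)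
    [set chi : X | forall h : val chi (Jdom (gel p)), O (mkgerm (GPair h))].

Lemma germ_openT : germ_open setT.
Proof. by move=> p _; exact: filterE. Qed.

Lemma germ_openI : setI_closed germ_open.
Proof.
move=> O P hO hP p [Op Pp].
by apply: filterS (filterI (hO p Op) (hP p Pp)) => chi /= [h h'] h''.
Qed.

Lemma germ_open_bigU (K : Type) (f : K -> set germ) :
  (forall i, germ_open (f i)) -> germ_open (\bigcup_i f i).
Proof.
move=> hf p [i _ fi]; apply: filterS (hf i p fi) => chi /= h h'.
by exists i.
Qed.

HB.instance Definition _ := isOpenTopological.Build germ
  germ_openT germ_openI germ_open_bigU.

Lemma germ_openE (O : set germ) : open O = germ_open O.
Proof. by []. Qed.

Lemma germ_rel_le p q : germ_rel p q ->
  forall e : J, val (gpt p) (Jpre (gel p) e) -> val (gpt p) (Jpre (gel q) e).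
Proof.
move=> [eq_pt [A hA eA]] e; apply: (gfam_le hA) => x /= [[y ey sy] Ax].
by exists y => //; apply/(prestrE eA _ Ax).
Qed.

Lemma bdact_germ p q : germ_rel p q -> bdact (gdom p) = bdact (gdom q).
Proof.
move=> pq; apply: val_inj; apply/funext => e /=; rewrite /act -(proj1 pq).
apply/idP/idP; first exact: germ_rel_le.
rewrite [in X in X -> _](proj1 pq) (proj1 pq).
exact: germ_rel_le (germ_relC pq) _.
Qed.

Lemma bdact_dom_inv s (chi : X) (h : val chi (Jdom s)) :
  val (bdact h) (Jdom (Iinv s)).
Proof. by rewrite /= act_dom_inv. Qed.

Lemma bdact_dom_mul s t (chi : X) (h : val chi (Jdom t))
  (h' : val (bdact h) (Jdom s)) : val chi (Jdom (Imul s t)).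
Proof. by rewrite -Jpre_Jdom. Qed.

Definition gpair_mul p q (e : gpt p = bdact (gdom q)) : gpair :=
  @GPair (Imul (gel p) (gel q)) (gpt q) (bdact_dom_mul
    (eq_ind _ (fun chi : X => val chi (Jdom (gel p))) (gdom p) _ e)).

Definition germ_src (g : germ) : X := gpt (germ_repr g).

Definition germ_rng (g : germ) : X := bdact (gdom (germ_repr g)).

Definition germ_inv (g : germ) : germ :=
  mkgerm (GPair (bdact_dom_inv (gdom (germ_repr g)))).

Definition germ_mul (g h : germ) : germ :=
  match pselect (germ_src g = germ_rng h) with
  | left e => mkgerm (gpair_mul e)
  | right _ => g
  end.

Lemma Jhat_neq0 (chi : X) : exists e, val chi (Jdom (Iid e)).
Proof.
case: (JhatX chi) => -[e he] _ _; exists e.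
by apply: Jhat_le he; [exact: JhatX | move=> x ex; exists x].
Qed.

Definition germ_unit (chi : X) : germ := mkgerm (GPair (projT2 (cid (Jhat_neq0 chi)))).

Lemma germ_reprP p : germ_rel (germ_repr (mkgerm p)) p.
Proof. by apply/germP; exact: germ_reprK. Qed.

Lemma germ_srcE p : germ_src (mkgerm p) = gpt p.
Proof. by case: (germ_reprP p). Qed.

Lemma germ_rngE p : germ_rng (mkgerm p) = bdact (gdom p).
Proof. exact/bdact_germ/germ_reprP. Qed.

Lemma bdactK s (chi : X) (h : val chi (Jdom s)) : bdact (bdact_dom_inv h) = chi.
Proof. by apply: val_inj; exact: actK (JhatX chi) h. Qed.

Lemma germ_invE p : germ_inv (mkgerm p) = mkgerm (GPair (bdact_dom_inv (gdom p))).
Proof.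
apply/germP; move: (germ_reprP p); set q := germ_repr _ => qp.
split; first exact: bdact_germ.
case: (qp) => _ [A hA eA] /=; exists (pimage (val (gel q)) A).
  apply: (@gfam_pre N (Iinv (gel q)) _ (bdact_dom_inv (gdom q)) A).
  by rewrite bdactK.
apply: prestrP => x y [a Aa qa] /=; split=> h.
  by rewrite (@pbij_inj _ (val (gel q)) _ _ _ h qa); apply/(prestrE eA _ Aa).
have pa := proj1 (prestrE eA x Aa) qa.
by rewrite (@pbij_inj _ (val (gel p)) _ _ _ h pa).
Qed.

Lemma gpair_mul_rel p p' q q' (e : gpt p = bdact (gdom q))
  (e' : gpt p' = bdact (gdom q')) :
  germ_rel p p' -> germ_rel q q' -> germ_rel (gpair_mul e) (gpair_mul e').
Proof.
move=> [_ [A hA eA]] [eq_pt [B hB eB]]; split=> //.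
exists (pimage (pinv (val (gel q))) A `&` B).
  apply: gfam_setI => //; apply: (@gfam_pre N _ _ (gdom q)).
  by rewrite -e.
apply: prestrP => x z [[y Ay qy] Bx] /=; split=> -[y' h h'].
  have yy' := @pbij_fun _ (val (gel q)) _ _ _ qy h; subst y'.
  by exists y; [apply/(prestrE eB _ Bx) | apply/(prestrE eA _ Ay)].
have qy' := proj2 (prestrE eB y' Bx) h.
have yy' := @pbij_fun _ (val (gel q)) _ _ _ qy qy'; subst y'.
by exists y => //; apply/(prestrE eA _ Ay).
Qed.

Lemma germ_mulE p q (e : gpt p = bdact (gdom q)) :
  germ_mul (mkgerm p) (mkgerm q) = mkgerm (gpair_mul e).
Proof.
rewrite /germ_mul; case: pselect => [e'|]; last first.
  by rewrite germ_srcE germ_rngE.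
by apply/germP; apply: gpair_mul_rel; exact: germ_reprP.
Qed.

Lemma germ_unitE (chi : X) (e : J) (h : val chi (Jdom (Iid e))) :
  germ_unit chi = mkgerm (GPair h).
Proof.
apply/germP; case: (cid _) => f hf /=; split=> //=.
exists (val (Jdom (Iid f)) `&` val (Jdom (Iid e))).
  by apply: gfam_setI; exact: gfam_val.
by apply: prestrP => x y [[? [fx _]] [? [ex _]]]; rewrite /=; split=> -[_ <-].
Qed.

Lemma germ_ex g : exists p, g = mkgerm p.
Proof. by exists (germ_repr g); rewrite germ_reprK. Qed.

Lemma germ_src_unit (chi : X) : germ_src (germ_unit chi) = chi.
Proof. exact: germ_srcE. Qed.

Lemma bdact_id e (chi : X) (h : val chi (Jdom (Iid e))) : bdact h = chi.
Proof.
apply: val_inj; apply/funext => f; rewrite /= /act.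
have -> : Jpre (Iid e) f = Jcap f (Jdom (Iid e)).
  apply: val_inj; rewrite /= eqEsubset; split=> x /=.
    by move=> [y fy [ex xy]]; subst y; split=> //; exists x.
  by move=> [fx [y [ex _]]]; exists x.
by case: (JhatX chi) => _ -> _; rewrite h andbT.
Qed.

Lemma germ_rng_unit (chi : X) : germ_rng (germ_unit chi) = chi.
Proof. by rewrite germ_rngE bdact_id. Qed.

Lemma germ_src_mul g h :
  germ_src g = germ_rng h -> germ_src (germ_mul g h) = germ_src h.
Proof.
case: (germ_ex g) => p ->; case: (germ_ex h) => q ->; rewrite germ_srcE germ_rngE => e.
by rewrite (germ_mulE e) !germ_srcE.
Qed.

Lemma germ_rng_mul g h :
  germ_src g = germ_rng h -> germ_rng (germ_mul g h) = germ_rng g.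
Proof.
case: (germ_ex g) => p ->; case: (germ_ex h) => q ->; rewrite germ_srcE germ_rngE => e.
rewrite (germ_mulE e) !germ_rngE; apply: val_inj => /=.
by rewrite act_mul e.
Qed.

Lemma gpair_germ p q : gpt p = gpt q -> val (gel p) = val (gel q) ->
  mkgerm p = mkgerm q.
Proof.
move=> e e'; apply/germP; split=> //; exists (val (Jdom (gel p))).
  exact/gfam_val/gdom.
by rewrite e'.
Qed.

Lemma germ_mulA g h k : germ_src g = germ_rng h -> germ_src h = germ_rng k ->
  germ_mul g (germ_mul h k) = germ_mul (germ_mul g h) k.
Proof.
case: (germ_ex g) => p ->; case: (germ_ex h) => q ->; case: (germ_ex k) => r ->.
rewrite !germ_srcE !germ_rngE => e e'.
have e1 : gpt p = bdact (gdom (gpair_mul e')).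
  by rewrite e; apply: val_inj; rewrite /= act_mul e'.
rewrite (germ_mulE e') (germ_mulE e1) (germ_mulE e).
have e2 : gpt (gpair_mul e) = bdact (gdom r) by [].
rewrite (germ_mulE e2); apply: gpair_germ => //=.
apply: pbijP => x y /=; split.
  by move=> [z [w xw wz] zy]; exists w => //; exists z.
by move=> [w xw [z wz zy]]; exists z => //; exists w.
Qed.

Lemma germ_mul1 g : germ_mul g (germ_unit (germ_src g)) = g.
Proof.
case: (germ_ex g) => p ->; rewrite germ_srcE.
have h : val (gpt p) (Jdom (Iid (Jdom (gel p)))).
  by apply: Jhat_le (JhatX _) _ (gdom p) => x xd; exists x.
rewrite (germ_unitE h).
have e : gpt p = bdact (gdom (GPair h)) by rewrite bdact_id.
rewrite (germ_mulE e); apply: gpair_germ => //=.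
apply: pbijP => x y /=; split; first by move=> [z [_ <-]].
by move=> xy; exists x => //; split=> //; exists y.
Qed.

Lemma germ_1mul g : germ_mul (germ_unit (germ_rng g)) g = g.
Proof.
case: (germ_ex g) => p ->; rewrite germ_rngE.
have h : val (bdact (gdom p)) (Jdom (Iid (Jdom (Iinv (gel p))))).
  apply: Jhat_le (JhatX _) _ (bdact_dom_inv (gdom p)) => x xd.
  by exists x.
rewrite (germ_unitE h).
have e : gpt (GPair h) = bdact (gdom p) by [].
rewrite (germ_mulE e); apply: gpair_germ => //=.
apply: pbijP => x y /=; split; first by move=> [z xz [_ <-]].
by move=> xy; exists y => //; split=> //; exists x.
Qed.

Lemma germ_src_inv g : germ_src (germ_inv g) = germ_rng g.
Proof. by case: (germ_ex g) => p ->; rewrite germ_invE germ_srcE germ_rngE. Qed.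

Lemma germ_rng_inv g : germ_rng (germ_inv g) = germ_src g.
Proof.
by case: (germ_ex g) => p ->; rewrite germ_invE germ_srcE germ_rngE bdactK.
Qed.

Lemma germ_invmul g : germ_mul (germ_inv g) g = germ_unit (germ_src g).
Proof.
case: (germ_ex g) => p ->; rewrite germ_invE germ_srcE.
have h : val (gpt p) (Jdom (Iid (Jdom (gel p)))).
  by apply: Jhat_le (JhatX _) _ (gdom p) => x xd; exists x.
have e : gpt (GPair (bdact_dom_inv (gdom p))) = bdact (gdom p) by [].
rewrite (germ_unitE h) (germ_mulE e); apply: gpair_germ => //=.
apply: pbijP => x y /=; split.
  move=> [z xz yz]; split; first by exists z.
  exact: (@pbij_inj _ (val (gel p)) _ _ _ xz yz).
by move=> [[z xz] <-]; exists z.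
Qed.

Lemma germ_invK g : germ_inv (germ_inv g) = g.
Proof.
case: (germ_ex g) => p ->; rewrite !germ_invE; apply: gpair_germ => /=.
  exact: bdactK.
exact: pbijP.
Qed.

Lemma germ_mulinv g : germ_mul g (germ_inv g) = germ_unit (germ_rng g).
Proof. by rewrite -{1}(germ_invK g) germ_invmul germ_src_inv. Qed.

Lemma germ_src_continuous : continuous germ_src.
Proof.
apply/continuousP => U oU; rewrite germ_openE => p /=; rewrite germ_srcE => Up.
apply: filterS (open_nbhs_nbhs (conj oU Up)) => chi Uchi h /=.
by rewrite germ_srcE.
Qed.

Lemma germ_rng_continuous : continuous germ_rng.
Proof.
apply/continuousP => U oU; rewrite germ_openE => p /=; rewrite germ_rngE => Up.
apply: filterS (near_bdact (open_nbhs_nbhs (conj oU Up))) => chi Uchi h /=.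
by rewrite germ_rngE.
Qed.

Lemma germ_unit_continuous : continuous germ_unit.
Proof.
apply/continuousP => O; rewrite germ_openE openE => hO chi /= Ochi.
have [e h] := Jhat_neq0 chi.
rewrite (germ_unitE h) in Ochi.
apply: filterS (filterI (hO _ Ochi) (near_valX (near_char h))) => psi /= [Opsi h'].
by rewrite (germ_unitE h').
Qed.

Lemma germ_inv_continuous : continuous germ_inv.
Proof.
apply/continuousP => O; rewrite !germ_openE => hO p /=; rewrite germ_invE => Op.
apply: filterS (near_bdact (hO _ Op)) => chi /= h h'.
by rewrite germ_invE; exact: h.
Qed.

Lemma bisection_open s (U : set X) : open U ->
  open [set g : germ | exists (chi : X) (h : val chi (Jdom s)),
          U chi /\ g = mkgerm (GPair h)].
Proof.
move=> oU; rewrite germ_openE => p [chi [h [Uchi /germP[/= epc [A hA eA]]]]].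
have hs : val (gpt p) (Jdom s) by rewrite epc.
rewrite -epc in Uchi.
apply: filterS (filterI (gfam_near hA) (filterI (near_valX (near_char hs))
  (open_nbhs_nbhs (conj oU Uchi)))) => psi /= [hA' [hs' Upsi]] h'.
by exists psi, hs'; split=> //; apply/germP; split=> //; exists A.
Qed.

Lemma germ_mul_continuous :
  {within [set gh | germ_src gh.1 = germ_rng gh.2],
    continuous (fun gh => germ_mul gh.1 gh.2)}.
Proof.
apply/subspace_continuousP => -[g h] /= egh O.
rewrite nbhsE => -[O' [oO' O'gh] sO].
suff : nbhs (g, h) [set gh : germ * germ |
    germ_src gh.1 = germ_rng gh.2 -> O (germ_mul gh.1 gh.2)] by [].
case: (germ_ex g) (germ_ex h) egh O'gh => p -> [q ->].
rewrite germ_srcE germ_rngE => e; rewrite /from_subspace /= (germ_mulE e) => O'pq.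
have := oO'; rewrite germ_openE => /(_ _ O'pq) /=.
rewrite nbhsE => -[U [oU Uq] sU].
pose V := [set k : germ | exists (chi : X) (h : val chi (Jdom (gel p))),
          [set: X] chi /\ k = mkgerm (GPair h)].
pose W := [set k : germ | exists (chi : X) (h : val chi (Jdom (gel q))),
          U chi /\ k = mkgerm (GPair h)].
exists (V, W) => /=.
  split; apply: open_nbhs_nbhs; split.
  - exact: bisection_open openT.
  - by exists (gpt p), (gdom p); split=> //; case: (p).
  - exact: bisection_open.
  - by exists (gpt q), (gdom q); split=> //; case: (q).
move=> [_ _] /= [[chi [h1 [_ ->]]] [psi [k [Upsi ->]]]] /=.
rewrite germ_srcE germ_rngE => e'.
by rewrite (germ_mulE e'); apply: sO; exact: sU.
Qed.

Lemma germ_src_etale g : exists U : set germ,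
  [/\ open U, U g, {in U &, injective germ_src} &
      forall V, open V -> V `<=` U -> open (germ_src @` V)].
Proof.
case: (germ_ex g) => p ->.
exists [set k : germ | exists (chi : X) (h : val chi (Jdom (gel p))),
          [set: X] chi /\ k = mkgerm (GPair h)]; split.
- exact: bisection_open openT.
- by exists (gpt p), (gdom p); split=> //; case: (p).
- move=> _ _ /set_mem[chi [h [_ ->]]] /set_mem[psi [k [_ ->]]].
  by rewrite !germ_srcE /= => e; exact: gpair_germ.
- move=> V; rewrite germ_openE openE => oV _ _ [g' Vg <-].
  case: (germ_ex g') Vg => q -> Vq; rewrite germ_srcE.
  apply: filterS (filterI (oV _ Vq) (near_valX (near_char (gdom q)))) => chi.
  move=> /= [h h']; exists (mkgerm (GPair h')) => //.
  by rewrite germ_srcE.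
Qed.

Definition germGroupoid : etaleGroupoid :=
  @EtaleGroupoid X germ germ_src germ_rng germ_unit germ_inv germ_mul
    germ_src_unit germ_rng_unit germ_src_mul germ_rng_mul germ_mulA germ_mul1
    germ_1mul germ_src_inv germ_rng_inv germ_invmul germ_mulinv
    germ_src_continuous germ_rng_continuous germ_unit_continuous
    germ_inv_continuous germ_mul_continuous germ_src_etale.

End Germs.

(* [I_l |>< bdOmega], where [(s, chi)] and [(t, chi)] are identified when
   [s e = t e] for some [e] in [calJ] with [chi e = 1]. *)
Definition Il_groupoid : etaleGroupoid := germGroupoid char_family.

(* The variant in which [e] is replaced by differences [e \ (f_1 U ... U f_n)]
   of sets in [calJ]. *)
Definition Ilbar_groupoid : etaleGroupoid := germGroupoid charbar_family.

End LeftCancellative.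

(* Main.v *)
From HB Require Import structures.
Require Import Defs.
From mathcomp Require Import all_boot.
From mathcomp Require Import finmap.
From mathcomp Require Import all_classical.
From mathcomp Require Import topology.

(** Which germs are identified has no influence on ranges: in both groupoids
the arrow [s, chi] goes from chi to s.chi. Hence a set of units is invariant for
either groupoid exactly when it is invariant under the partial action of I_l on
the boundary X, and both minimality properties say that X has no closed
invariant subsets other than the trivial ones ([act_minimal]).

For f in J let X(f) be the set of the chi in X with chi(f) = 1. The sets X(f)
with f non-empty are non-empty, and they form a pi-base of X: each non-empty
open set contains one of them ([bdOmega_nbhs]). Indeed maximal characters are
dense in X, and around a maximal chi the sets X(f) with chi(f) = 1 are already a
base of neighbourhoods, because a condition chi(e) = 0 is forced by
chi(g) = 1 for some g disjoint from e. Therefore the partial action is minimal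
if and only if, for each non-empty f, the orbit of every chi in X meets X(f),
that is, chi(s^-1 f s) = 1 for some s ([act_minimalP]).

It remains to compare this with the finiteness in condition (iii), for fixed e
and f ([orbit_finite]). If every chi in X(e) satisfies chi(s^-1 f s) = 1 for
some s, then finitely many s suffice, because X(e) is compact: it is closed in
the product {0,1}^J, where the condition chi(e) = 1 prevents characters from
degenerating to zero in the limit. A non-empty e' contained in e belongs to some
chi in X(e), and then e' meets the set s^-1 f s for which chi(s^-1 f s) = 1.
Conversely, if chi in X(e) vanishes at the finitely many sets s_i^-1 f s_i, then
so do all characters near chi, and the pi-base provides a non-empty e' contained
in e that meets none of these sets. *)

Set Implicit Arguments.
Unset Strict Implicit.
Unset Printing Implicit Defensive.

Local Open Scope classical_set_scope.

Section Characters.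
Variables (C : smallCategory) (hC : left_cancellative C).

Local Notation J := (set_type (calJ hC)).
Local Notation I := (set_type (Il hC)).
Local Notation X := (set_type (@bdOmega C hC)).
Implicit Types (e f g : J) (s t : I).

(** * Maximal characters *)

Lemma Jhat_neq_set0 (chi : {ptws J -> bool}) e :
  Jhat chi -> chi e -> val e !=set0.
Proof.
move=> [_ _ chi0] he; apply/set0P/eqP => /chi0 e0.
by rewrite e0 in he.
Qed.

(** Zorn's lemma, applied to the extensions of the character of evaluation at a
point [x] of [e]. The sets [A] of the chain carry this character along in
[S A], so that the union of the empty chain also gives a character. *)
Lemma Jhat_max_exists e : val e !=set0 ->
  exists2 chi : {ptws J -> bool}, Jhat_max chi & chi e.
Proof.
move=> [x ex].
pose S (A : set J) : set J := A `|` [set f | val f x].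
pose chr (A : set J) : {ptws J -> bool} := fun f => `[< S A f >].
have chain_ub F : F `<=` [set A | Jhat (chr A)] -> total_on F subset ->
    Jhat (chr (\bigcup_(A in F) A)).
  move=> FJ Ftot; split.
  - by exists e; apply/asboolP; right.
  - have up A f g : F A -> val f `<=` val g -> S A f -> S A g.
      move=> FA fg /asboolP fA.
      by apply/asboolP; exact: Jhat_le (FJ _ FA) fg fA.
    have meet A f g : F A -> S A f -> S A g -> S A (Jcap f g).
      move=> /FJ[_ chM _] /asboolP fA /asboolP gA.
      by apply/asboolP; move: (chM f g); rewrite /chr fA gA.
    have SU A f : F A -> S A f -> S (\bigcup_(A in F) A) f.
      by move=> FA [Af|fx]; [left; exists A | right].
    move=> f g; apply/asboolP/andP => [[[A FA Afg]|[fx gx]]|[]].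
    + by split; apply/asboolP; apply: (SU A) => //;
        apply: (up A (Jcap f g)) => //; [move=> y [] | left | move=> y [] | left].
    + by split; apply/asboolP; right.
    + move=> /asboolP[[A FA Af]|fx] /asboolP[[B FB Bg]|gx].
      * have [AB|BA] := Ftot A B FA FB.
          by apply: (SU B) => //; apply: meet => //; left => //; exact: AB.
        by apply: (SU A) => //; apply: meet => //; left => //; exact: BA.
      * by apply: (SU A) => //; apply: meet => //; [left | right].
      * by apply: (SU B) => //; apply: meet => //; [right | left].
      * by right.
  - move=> f f0; apply/asboolP => -[[A FA Af]|]; last by rewrite /= f0.
    have [_ _ chA0] := FJ A FA.
    by move/asboolP: (chA0 f f0); apply; left.
have [A [hA Amax]] := Zorn_bigcup chain_ub.
exists (chr A); last by apply/asboolP; right.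
split=> // psi hpsi sub; rewrite eqEsubset; split=> // f psif.
have subS g : S A g -> psi g by move=> Ag; apply: sub; apply/asboolP.
apply: contrapT => nf; apply: (Amax [set g | psi g]).
  split; last by move=> /(_ f psif) Af; apply: nf; apply/asboolP; left.
  by move=> g Ag; apply: subS; left.
suff E : chr [set g | psi g] = psi by rewrite /mkset E.
apply/funext => g; apply/asboolP/idP => [[//|gx]|]; last by left.
by apply: subS; right.
Qed.

(** At a maximal character the positive conditions alone describe the topology:
if [chi e] is false then, by maximality, [chi f] holds for some [f] disjoint
from [e], and [psi f] forces [psi e] to be false. *)
Lemma nbhs_Jhat_max (chi : {ptws J -> bool}) (U : set {ptws J -> bool}) :
  Jhat_max chi -> nbhs chi U ->
  exists2 f, chi f & forall psi, Jhat psi -> psi f -> U psi.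
Proof.
move=> mchi; have [hchi _] := mchi; have [[e0 he0] chiM _] := hchi.
pose F : set_system {ptws J -> bool} := [set U |
  exists2 f, chi f & forall psi, Jhat psi -> psi f -> U psi].
have FF : Filter F.
  split; first by exists e0.
    move=> P Q [f hf fP] [g hg gQ]; exists (Jcap f g).
      by rewrite chiM hf hg.
    move=> psi hpsi; have [_ psiM _] := hpsi; rewrite psiM => /andP[pf pg].
    by split; [exact: fP | exact: gQ].
  by move=> P Q PQ [f hf fP]; exists f => // psi hpsi pf; apply/PQ/fP.
(* Convergence in the product topology is tested one coordinate at a time. *)
suff : F --> chi by apply.
apply/cvg_sup => e V [_ [[W oW <-] /= Wchi] sWV].
suff [f hf fe] : exists2 f, chi f &
    forall psi, Jhat psi -> psi f -> psi e = chi e.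
  exists f => // psi hpsi pf; apply: sWV.
  by rewrite /= fe.
have [he|ne] := boolP (chi e); first by exists e.
have [f hf fe] : exists2 f, chi f & val f `&` val e = set0.
  apply: contrapT => h; move/negP: ne; apply; apply: (Jhat_max_extend mchi).
  by move=> g hg; apply/set0P/eqP => ge0; apply: h; exists g.
exists f => // psi [_ psiM psi0] pf; apply/negbTE/negP => pe.
by have := psi0 (Jcap f e) fe; rewrite psiM pf pe.
Qed.

(** * The boundary *)

Lemma Jhat_max_bdOmega : @Jhat_max C hC `<=` @bdOmega C hC.
Proof.
move=> chi mchi; split; [exact: subset_closure | exact: Jhat_max_Omega].
Qed.

Lemma bdOmega_exists e : val e !=set0 -> exists chi : X, val chi e.
Proof.
move=> /Jhat_max_exists[chi mchi he].
by exists (exist _ chi (mem_set (Jhat_max_bdOmega mchi))).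
Qed.

(** The pi-base of the boundary, obtained from a maximal character in [U]. It
does not provide neighbourhoods of [chi] itself, which may lie outside. *)
Lemma bdOmega_nbhs (chi : X) (U : set X) : nbhs chi U ->
  exists2 f, val f !=set0 & forall psi : X, val psi f -> U psi.
Proof.
move=> [_ [[W oW <-] /= Wchi] sWU].
have [clchi _] := valX chi.
have [psi [mpsi Wpsi]] := clchi W (open_nbhs_nbhs (conj oW Wchi)).
have [f psif fW] := nbhs_Jhat_max mpsi (open_nbhs_nbhs (conj oW Wpsi)).
exists f; first by apply: Jhat_neq_set0 psif; case: mpsi.
move=> phi phif; apply: sWU; apply: fW => //; exact: JhatX.
Qed.

Lemma near_char_all (chi : {ptws J -> bool}) n (g : 'I_n -> J) :
  nbhs chi [set psi : {ptws J -> bool} | forall i, psi (g i) = chi (g i)].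
Proof.
exact: (@filter_forall {ptws J -> bool} 'I_n
  (fun i psi => psi (g i) = chi (g i)) (nbhs chi) _
  (fun i => near_char_eq chi (g i))).
Qed.

(** Each axiom of [Omega] involves finitely many elements of [J], where [chi]
agrees with some maximal character. The exception is that [chi] is not zero:
limits of characters may vanish identically, and [e] excludes this. *)
Lemma closure_Jhat_max_Omega (chi : {ptws J -> bool}) e :
  closure (@Jhat_max C hC) chi -> chi e -> Omega chi.
Proof.
move=> cl he.
have near_max (P : set {ptws J -> bool}) : nbhs chi P ->
    exists2 psi, Jhat_max psi & P psi.
  by move=> nP; have [psi [mpsi Ppsi]] := cl P nP; exists psi.
split; first split.
- by exists e.
- move=> f g.
  have [psi [[_ psiM _] _] [[/= fE gE] fgE]] := near_max _
    (filterI (filterI (near_char_eq chi f) (near_char_eq chi g))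
      (near_char_eq chi (Jcap f g))).
  by rewrite -fE -gE -fgE psiM.
- move=> f f0.
  have [psi [[_ _ psi0] _] /= <-] := near_max _ (near_char_eq chi f).
  exact: psi0.
- move=> f n g fg hf.
  have [psi /Jhat_max_Omega[_ psiU] [/= gE fE]] := near_max _
    (filterI (near_char_all chi g) (near_char_eq chi f)).
  have [|i gi] := psiU f n g fg; first by rewrite fE.
  by exists i; rewrite -gE.
Qed.

Lemma closed_cylinder e (P : pred bool) :
  closed [set chi : {ptws J -> bool} | P (chi e)].
Proof.
have /continuous_closedP := @Defs.eval_continuous C hC e.
move=> /(_ [set b | P b]); apply.
exact: discrete_closed.
Qed.

Lemma open_cylinder e (P : pred bool) :
  open [set chi : {ptws J -> bool} | P (chi e)].
Proof.
have /continuousP := @Defs.eval_continuous C hC e.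
move=> /(_ [set b | P b]); apply.
exact: discrete_open.
Qed.

(** Tychonoff's theorem; the boundary itself need not be compact, as it may fail
to be closed at the zero map. *)
Lemma compact_bdOmega e :
  compact [set chi : {ptws J -> bool} | bdOmega chi /\ chi e].
Proof.
have -> : [set chi : {ptws J -> bool} | bdOmega chi /\ chi e] =
    closure (@Jhat_max C hC) `&` [set chi : {ptws J -> bool} | chi e].
  rewrite eqEsubset; split=> chi /=; first by move=> [[]].
  move=> [cl he]; split=> //; split=> //; exact: closure_Jhat_max_Omega he.
have cT : compact [set: {ptws J -> bool}].
  have := @tychonoff J (fun=> bool) (fun=> setT) (fun=> bool_compact).
  by congr (compact _); rewrite eqEsubset; split.
apply: (subclosed_compact _ cT) => //.
apply: closedI; first exact: closed_closure.
exact: (@closed_cylinder e id).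
Qed.

Lemma finite_cover e f :
  (forall chi : X, val chi e -> exists s, val chi (Jpre s f)) ->
  exists n (s : 'I_n -> I),
    forall chi : X, val chi e -> exists i, val chi (Jpre (s i) f).
Proof.
(* The covering form of compactness asks for a base point; any one will do. *)
pose pT : ptopologicalType := HB.pack {ptws J -> bool}
  (isPointed.Build {ptws J -> bool} (fun=> false)).
move=> cov; have : @cover_compact pT
    [set chi : {ptws J -> bool} | bdOmega chi /\ chi e].
  by rewrite -compact_cover; exact: @compact_bdOmega.
move=> /(_ {classic I} setT
  (fun s => [set chi : {ptws J -> bool} | chi (Jpre s f)])).
case.
- by move=> s _; exact: (@open_cylinder (Jpre s f) id).
- move=> chi [bchi he].
  by have [s hs] := cov (exist _ chi (mem_set bchi)) he; exists s.
move=> D _ Dcov.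
exists (size D), (tnth (in_tuple D)) => chi he.
have [|s /= sD hs] := Dcov (val chi); first by split=> //; exact: valX.
have /tnthP[i si] : s \in in_tuple (enum_fset D) by [].
by exists i; rewrite -si.
Qed.

(** * Minimality of the partial action *)

Definition act_invariant (A : set X) :=
  forall s (chi : X) (h : val chi (Jdom s)), A chi -> A (bdact h).

Definition act_minimal :=
  forall A : set X, closed A -> act_invariant A -> A = set0 \/ A = setT.

Lemma invariant_germP (N : germFamily hC) (A : set X) :
  @Defs.invariant (germGroupoid N) A <-> act_invariant A.
Proof.
split=> [inv s chi h Achi | inv g].
  have := inv (mkgerm N (GPair h)).
  by rewrite /= germ_srcE germ_rngE; apply.
have [p ->] := germ_ex g.
by rewrite /= germ_srcE germ_rngE; apply: inv.
Qed.

Lemma minimal_germP (N : germFamily hC) :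
  minimal (germGroupoid N) <-> act_minimal.
Proof.
split=> hmin A clA invA; apply: (hmin A clA).
  exact: (proj2 (invariant_germP N A)).
exact: (proj1 (invariant_germP N A)).
Qed.

Lemma Jpre_mul s t e : Jpre t (Jpre s e) = Jpre (Imul s t) e.
Proof.
apply: val_inj; rewrite /= eqEsubset; split=> x /=.
  by move=> [y [z ez sz] ty]; exists z => //; exists y.
by move=> [z ez [y ty sz]]; exists y => //; exists z.
Qed.

Lemma act_invariant_meets f (A : set X) : act_invariant A ->
  (forall chi : X, exists s, val chi (Jpre s f)) ->
  A !=set0 -> exists2 chi, A chi & val chi f.
Proof.
move=> inv orb [chi Achi]; have [s hs] := orb chi.
have h : val chi (Jdom s).
  by apply: Jhat_le (JhatX chi) _ hs => x [y _ sy]; exists y.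
by exists (bdact h); [exact: inv | ].
Qed.

(** The characters whose orbits avoid the open set given by [f] form a closed
invariant set. It is not everything, because some character contains [f], so
minimality makes it empty. Conversely, an invariant set that meets all sets of
the pi-base is dense. *)
Lemma act_minimalP : act_minimal <->
  forall f, val f !=set0 -> forall chi : X, exists s, val chi (Jpre s f).
Proof.
split=> [hmin f f0 chi | orb A clA inv].
  pose A : set X := [set psi | forall s, ~~ val psi (Jpre s f)].
  apply: contrapT => nchi.
  have [| |A0|AT] := hmin A.
  - rewrite (_ : A = \bigcap_s [set psi : X | ~~ val psi (Jpre s f)]).
      apply: closed_bigI => s _.
      have /continuous_closedP clv : continuous (val : X -> {ptws J -> bool}).
        by move=> psi U; exact: near_valX.
      exact: (clv _ (@closed_cylinder (Jpre s f) negb)).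
    rewrite eqEsubset; split=> psi h s; first by move=> _; exact: h.
    exact: (h s Logic.I).
  - by move=> t psi h Apsi s; rewrite /= /act Jpre_mul; exact: Apsi.
  - have : A chi by move=> s; apply/negP => hs; apply: nchi; exists s.
    by rewrite A0.
  - have [psi hf] := bdOmega_exists f0.
    have : A psi by rewrite AT.
    move=> /(_ (Iid f)) /negP; apply; apply: Jhat_le (JhatX psi) _ hf.
    by move=> x fx; exists x.
have [|/set0P A0] := eqVneq A set0; [by left | right].
rewrite -subTset => chi _; apply: (clA chi) => U /bdOmega_nbhs[f f0 fU].
have [psi Apsi /fU] := act_invariant_meets inv (orb f f0) A0.
by exists psi.
Qed.

(** * Reduction to finitely many translates *)

(** Forwards, compactness yields the finite family, and a character that
contains both [e'] and [s_i^-1 f s_i] shows that these sets meet. Backwards, a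
[chi] that vanishes on all [s_i^-1 f s_i] gives a whole neighbourhood of such
characters, and the pi-base supplies [g] such that every character containing
[g] lies in it; then [e `&` g] meets none of the [s_i^-1 f s_i]. *)
Lemma orbit_finite e f :
  (forall chi : X, val chi e -> exists s, val chi (Jpre s f)) <->
  exists n (s : 'I_n -> I), forall e', val e' !=set0 -> val e' `<=` val e ->
    exists i, val e' `&` val (Jpre (s i) f) !=set0.
Proof.
split=> [/finite_cover[n [s scov]]|[n [s smeet]] chi he].
  exists n, s => e' e'0 e'e.
  have [chi he'] := bdOmega_exists e'0.
  have [|i hi] := scov chi; first exact: Jhat_le (JhatX chi) e'e he'.
  exists i; apply: (@Jhat_neq_set0 (val chi) (Jcap e' (Jpre (s i) f))).
    exact: JhatX.
  by case: (JhatX chi) => _ -> _; rewrite he' hi.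
apply: contrapT => no.
have [g g0 gU] := bdOmega_nbhs (near_valX (filterI (near_char he)
  (near_char_all (val chi) (fun i => Jpre (s i) f)))).
have [psi hg] := bdOmega_exists g0.
have [he' _] := gU psi hg.
have : exists i, val (Jcap e g) `&` val (Jpre (s i) f) !=set0.
  apply: smeet; last by move=> x [].
  apply: (@Jhat_neq_set0 (val psi)); first exact: JhatX.
  by case: (JhatX psi) => _ -> _; rewrite he' hg.
move=> [i meet].
have [phi] := @bdOmega_exists (Jcap (Jcap e g) (Jpre (s i) f)) meet.
case: (JhatX phi) => _ phiM _; rewrite !phiM => /andP[/andP[_ phig] phii].
have [_ /(_ i) chii] := gU phi phig.
by apply: no; exists (s i); rewrite -chii.
Qed.

End Characters.

Lemma pconjE (T : Type) (s : pbij T) (A : set T) : pconj s A = pimage s A.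
Proof.
rewrite eqEsubset; split=> y [x Ax sxy]; exists x => //; first by case: Ax.
by split=> //; exists y.
Qed.

Theorem lemma5p4 (C : smallCategory) (hC : left_cancellative C) :
  (minimal (Il_groupoid hC) <-> minimal (Ilbar_groupoid hC)) /\
  (minimal (Il_groupoid hC) <->
    (forall e f : set C, calJ hC e -> calJ hC f -> e !=set0 -> f !=set0 ->
      exists n (s : 'I_n -> pbij C), (forall i, Il hC (s i)) /\
        forall e' : set C, calJ hC e' -> e' !=set0 -> e' `<=` e ->
          exists i, e' `&` pconj (s i) f !=set0)).
Proof.
split; first by rewrite !minimal_germP.
rewrite minimal_germP act_minimalP; split=> [orb e f Je Jf e0 f0|fin f f0 chi].
  pose eJ : set_type (calJ hC) := exist _ e (mem_set Je).
  pose fJ : set_type (calJ hC) := exist _ f (mem_set Jf).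
  have [n [s meet]] :=
    proj1 (orbit_finite eJ fJ) (fun chi _ => orb fJ f0 chi).
  (* [Jpre s f] is [s^-1 f s], while the statement conjugates by [s]. *)
  exists n, (fun i => Defs.pinv (val (s i))); split.
    by move=> i; constructor; exact: set_mem (valP (s i)).
  move=> e' Je' e'0 e'e.
  have [i hi] := meet (exist _ e' (mem_set Je')) e'0 e'e.
  by exists i; rewrite pconjE.
case: (JhatX chi) => -[e he] _ _.
have e0 := Jhat_neq_set0 (JhatX chi) he.
have [n [s [sI meet]]] := fin _ _ (set_mem (valP e)) (set_mem (valP f)) e0 f0.
apply: (proj2 (orbit_finite e f)) he.
exists n, (fun i => Iinv (exist _ (s i) (mem_set (sI i)))) => e' e'0 e'e.
have [i] := meet _ (set_mem (valP e')) e'0 e'e.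
by rewrite pconjE; exists i.
Qed.
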